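(* Let $d\ge1$ and let $(\rho_r)_{r\in\mathbb N^d}$ be complex numbers. There exists a time-homogeneous Markov process $(B_t)_{t\in\mathbb N}$ on the torus group $\mathbb T^d$, with the uniform distribution as a stationary distribution, such that for all $t\in\mathbb Z_+$, $r\in\mathbb N^d$ and $a\in[0,1]^d$ $$\mathbb E\big[e^{2\pi i B_t\cdot r}\mid B_{t-1}=a\big]=\rho_r\,e^{2\pi i a\cdot r},$$ if and only if there is a random variable $W$ on $[0,1]^d$ such that $$\rho_r=\mathbb E\big[e^{2\pi i W\cdot r}\big],\qquad r\in\mathbb N^d.$$
   Context: $\mathbb T=\mathbb R/\mathbb Z$, and points of $\mathbb T^d$ are represented by elements of $[0,1]^d$ with $0$ and $1$ identified in each coordinate. $\mathbb N=\{0,1,2,\ldots\}$, $\mathbb Z_+=\{1,2,\ldots\}$, and $a\cdot r$ is the inner product. Time-homogeneous means that the one-step transition kernel does not depend on $t$; the conditional expectation given $B_{t-1}=a$ is the integral with respect to this kernel started from $a$. The displayed equation says that the functions $b\mapsto e^{2\pi i b\cdot r}$ are eigenfunctions (''eigenvectors'') of the transition kernel with eigenvalues $\rho_r$. *)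

(* Defs.v *)
From HB Require Import structures.
From mathcomp Require Import all_boot all_order all_algebra.
From mathcomp Require Import archimedean generic_quotient ring_quotient.
From mathcomp Require Import complex.
From mathcomp Require Import all_classical all_reals all_analysis.

Set Implicit Arguments.
Unset Strict Implicit.
Unset Printing Implicit Defensive.

Import Order.TTheory GRing.Theory Num.Theory.
Import numFieldNormedType.Exports.

Local Open Scope classical_set_scope.
Local Open Scope ring_scope.
Local Open Scope quotient_scope.
Local Open Scope complex_scope.

(* The additive quotient group R / Z; the measurable sets are those whose
   preimage in R is Borel, i.e. the Borel sets of the quotient topology. *)
Definition circle (R : realType) : Type :=
  {ideal_quot (GRing.ZmodClosed.clone R Num.int_num_subdef _)}.

HB.instance Definition _ (R : realType) := GRing.Zmodule.on (circle R).
HB.instance Definition _ (R : realType) := EqQuotient.on (circle R).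
HB.instance Definition _ (R : realType) := isPointed.Build (circle R) 0.

Section circle_measurable.
Variable R : realType.

Definition circle_proj (x : measurableTypeR R) : circle R := \pi_(circle R) (x : R).

Definition circle_measurable : set_system (circle R) :=
  image_set_system [set: R] circle_proj measurable.

Lemma circle_sigma_algebra : sigma_algebra setT circle_measurable.
Proof. exact/sigma_algebra_image/sigma_algebra_measurable. Qed.

Let circle_measurable0 : circle_measurable set0.
Proof. by case: circle_sigma_algebra. Qed.

Let circle_measurableC A : circle_measurable A -> circle_measurable (~` A).
Proof. by case: circle_sigma_algebra => _ mC _ /mC; rewrite setTD. Qed.

Let circle_measurable_bigcup (F : (set (circle R))^nat) :
  (forall i, circle_measurable (F i)) -> circle_measurable (\bigcup_i F i).
Proof. by case: circle_sigma_algebra => _ _; exact. Qed.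

HB.instance Definition _ := @isMeasurable.Build default_measure_display
  (circle R) circle_measurable
  circle_measurable0 circle_measurableC circle_measurable_bigcup.

Lemma measurable_circle_proj :
  measurable_fun [set: measurableTypeR R] circle_proj.
Proof. by move=> _ A mA. Qed.

HB.instance Definition _ :=
  @isMeasurableFun.Build _ _ (measurableTypeR R) (circle R) circle_proj
    measurable_circle_proj.

Lemma circle_projP (x y : R) :
  circle_proj x = circle_proj y <-> x - y \is a Num.int.
Proof.
rewrite -[x - y \is a _]/(x - y \in GRing.ZmodClosed.clone R Num.int_num_subdef _).
by rewrite Quotient.idealrBE; split=> /eqP.
Qed.

End circle_measurable.

Definition torus (R : realType) (d : nat) : Type := d.-tuple (circle R).

HB.instance Definition _ (R : realType) (d : nat) := Measurable.on (torus R d).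

Definition torus_proj (R : realType) (d : nat) (a : d.-tuple R) : torus R d :=
  map_tuple (@circle_proj R) a.

Section power_probability.
Context d (T : measurableType d) (R : realType).

Definition cons_pair n (x : T * n.-tuple T) : n.+1.-tuple T :=
  [tuple of x.1 :: x.2].

Lemma measurable_cons_pair n : measurable_fun setT (@cons_pair n).
Proof. exact: measurable_cons. Qed.

HB.instance Definition _ n :=
  isMeasurableFun.Build _ _ _ _ (@cons_pair n) (@measurable_cons_pair n).

(* The n-fold product of P. *)
Fixpoint power_probability (P : probability T R) (n : nat) :
    probability (n.-tuple T) R :=
  match n with
  | 0 => \d_([tuple] : 0.-tuple T)
  | m.+1 => distribution (P \x power_probability P m)%E (@cons_pair m)
  end.

End power_probability.

Definition torus_uniform (R : realType) (d : nat) : probability (torus R d) R :=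
  power_probability
    (distribution (uniform_prob (@ltr01 R)) (@circle_proj R)) d.


(* exp (2 pi i x) *)
Definition cis (R : realType) (x : R) : R[i] :=
  cos (2 * pi * x) +i* sin (2 * pi * x).

Lemma cisDn (R : realType) (x : R) (n : nat) : cis (x + n%:R) = cis x.
Proof.
rewrite /cis mulrDr mulr_natr mulr_natl.
by rewrite (periodicn (@cosD2pi R)) (periodicn (@sinD2pi R)).
Qed.

Lemma cis_int (R : realType) (x y : R) : x - y \is a Num.int -> cis x = cis y.
Proof.
move=> /intrP[[n|n] xy].
  by rewrite -(subrK y x) xy addrC cisDn.
by rewrite -(subrK x y) -opprB xy NegzE mulrNz opprK addrC cisDn.
Qed.

Definition dot (R : realType) (d : nat) (a : d.-tuple R) (r : d.-tuple nat) : R :=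
  \sum_(i < d) tnth a i * (tnth r i)%:R.

Definition torus_char (R : realType) (d : nat) (r : d.-tuple nat)
    (b : torus R d) : R[i] :=
  cis (dot (map_tuple repr b) r).

(* The value does not depend on the representative chosen by repr. *)
Lemma torus_charE (R : realType) (d : nat) (r : d.-tuple nat) (a : d.-tuple R) :
  torus_char r (torus_proj a) = cis (dot a r).
Proof.
apply: cis_int; rewrite /dot -sumrB; apply: rpred_sum => i _.
rewrite !tnth_map -mulrBl rpredM ?natr_int//.
by apply/circle_projP; rewrite /circle_proj reprK.
Qed.

Definition cintegral d (T : measurableType d) (R : realType)
    (mu : {measure set T -> \bar R}) (f : T -> R[i]) : R[i] :=
  (\int[mu]_x complex.Re (f x))%R +i* (\int[mu]_x complex.Im (f x))%R.

Section markov.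
Context dO (Omega : measurableType dO) dS (S : measurableType dS).
Variable R : realType.

(* The sigma-algebra generated by B_0, ..., B_t. *)
Definition history (P : probability Omega R) (B : nat -> {RV P >-> S})
    (t : nat) : set_system Omega :=
  <<s \bigcup_(s in [set s | (s <= t)%N])
        preimage_set_system [set: Omega] (B s) measurable >>.

(* K t is the transition kernel from time t to time t + 1: for measurable A,
   K t (B_t, A) is a version of P (B_{t+1} \in A | B_0, ..., B_t). *)
Definition markov_process (P : probability Omega R) (B : nat -> {RV P >-> S})
    (K : nat -> R.-pker S ~> S) : Prop :=
  forall (t : nat) (E : set Omega) (A : set S),
    history B t E -> measurable A ->
    P (E `&` B t.+1 @^-1` A) = (\int[P]_(w in E) K t (B t w) A)%E.

Definition time_homogeneous (K : nat -> R.-pker S ~> S) : Prop :=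
  forall (s t : nat) (a : S) (A : set S), measurable A -> K s a A = K t a A.

Definition stationary (mu : probability S R) (K : nat -> R.-pker S ~> S) : Prop :=
  forall (t : nat) (A : set S), measurable A ->
    (\int[mu]_a K t a A)%E = mu A.

(* E [f (B_t) | B_{t-1} = a], for t > 0. *)
Definition cond_expectation_step (K : nat -> R.-pker S ~> S) (t : nat)
    (f : S -> R[i]) (a : S) : R[i] :=
  cintegral (K t.-1 a) f.

End markov.

Definition in_cube (R : realType) (d : nat) (a : d.-tuple R) : Prop :=
  forall i : 'I_d, 0 <= tnth a i <= 1.

(* Main.v *)
(* With chi_r b = e^(2 pi i b.r), chi_r (a + w) = chi_r a * chi_r w, so the
   kernel a |-> law of a + W has the chi_r as eigenvectors, with eigenvalues
   E chi_r(W).  Conversely, evaluating the eigenvector equation at a = 0 shows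
   that W can be taken to be the representative in [0, 1)^d of one step from 0.
   Given W, the process is the random walk whose steps are i.i.d. copies of W
   modulo 1; the uniform distribution is stationary because it is translation
   invariant.  The i.i.d. steps live on an infinite product space: the product
   measure is defined on the algebra of cylinders, and it is continuous at the
   empty set because, as long as the measures of a decreasing sequence of
   cylinders do not tend to 0, one can fix the first coordinate so that those
   of the sections do not either; Caratheodory's theorem then extends it. *)
Require Import Defs.
From HB Require Import structures.
From mathcomp Require Import all_boot all_order all_algebra.
From mathcomp Require Import complex.
From mathcomp Require Import all_classical all_reals all_analysis.
From mathcomp Require Import measurable_realfun.

Set Implicit Arguments.
Unset Strict Implicit.
Unset Printing Implicit Defensive.

Import Order.TTheory GRing.Theory Num.Theory.

Local Open Scope classical_set_scope.
Local Open Scope ring_scope.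
Local Open Scope complex_scope.

(** * Cylinder sets in the space of sequences *)

Definition sequence_space d (T : measurableType d) : Type := nat -> T.

Section cylinders.
Context d (T : measurableType d).
Local Notation S := (sequence_space T).

Definition initial n (x : S) : n.-tuple T := [tuple x i | i < n].

(** Padding with [point] gives a right inverse of [initial n], so the base of a cylinder can be
    recovered as a preimage under [extend n]. *)
Definition extend n (t : n.-tuple T) : S := nth point t.

Lemma extendK n : cancel (@extend n) (@initial n).
Proof.
by move=> t; apply: eq_from_tnth => i; rewrite tnth_mktuple (tnth_nth point).
Qed.

Lemma preimage_initial_inj n : injective (fun A => @initial n @^-1` A).
Proof.
by move=> A B AB; apply/seteqP; split=> t;
  rewrite -(extendK t) -[X in X -> _]/((initial n @^-1` _) _) ?AB// -AB.
Qed.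

Definition cylinder n : set_system S :=
  [set E | exists2 A, measurable A & E = initial n @^-1` A].

Definition cylinders : set_system S := [set E | exists n, cylinder n E].

(** The wider base is the preimage of the old one under truncation to the first [m] coordinates,
    which is measurable coordinate by coordinate. *)
Lemma cylinder_widen m n E : (m <= n)%N -> cylinder m E -> cylinder n E.
Proof.
move=> mn [A mA ->].
pose f (t : n.-tuple T) := [tuple tnth t (widen_ord mn i) | i < m].
have mf : measurable_fun setT f.
  apply/measurable_fun_tnthP => i.
  rewrite (_ : _ \o _ = @tnth _ _ ^~ (widen_ord mn i)); last first.
    by apply/funext => t /=; rewrite tnth_mktuple.
  exact: measurable_tnth.
exists (f @^-1` A); first by rewrite -[_ @^-1` _]setTI; exact: mf.
congr (_ @^-1` A); apply/funext => x; apply: eq_from_tnth => i.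
by rewrite /= !tnth_mktuple.
Qed.

Lemma cylindersT : cylinders setT.
Proof. by exists 0%N, setT. Qed.

Lemma cylinderD n : setD_closed (cylinder n).
Proof.
by move=> _ _ [A mA ->] [B mB ->]; exists (A `\` B) => //; exact: measurableD.
Qed.

Lemma cylindersD : setD_closed cylinders.
Proof.
move=> A B [m cA] [n cB]; exists (maxn m n).
by apply: cylinderD; [apply: cylinder_widen cA|apply: cylinder_widen cB];
  rewrite ?leq_maxl ?leq_maxr.
Qed.

HB.instance Definition _ := Pointed.copy S (nat -> T).
(** From here on, [measurable] on [S] means being a cylinder; these sets are only claimed to form an
    algebra. *)
HB.instance Definition _ :=
  @isAlgebraOfSets_setD.Build d S cylinders cylindersT cylindersD.

Definition scons (a : T) (x : S) : S := fun i => if i is j.+1 then x j else a.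

Lemma initial_scons n a x :
  initial n.+1 (scons a x) = cons_pair (a, initial n x).
Proof.
apply: eq_from_tnth => i; rewrite tnth_mktuple /cons_pair/=.
by have [j ->|->] := unliftP ord0 i; rewrite ?tnthS ?tnth0// tnth_mktuple.
Qed.

(** Fixing the first coordinate turns a cylinder into one with one coordinate less; inductions on
    the number of coordinates rest on this identity. *)
Lemma scons_initial n a A : scons a @^-1` (initial n.+1 @^-1` A) =
  initial n @^-1` (xsection (@cons_pair _ T n @^-1` A) a).
Proof.
apply/seteqP; split=> x /=; rewrite initial_scons.
  by rewrite /xsection/= inE.
by rewrite /xsection/= inE.
Qed.

Lemma measurable_section n a (A : set (n.+1.-tuple T)) : measurable A ->
  measurable (xsection (@cons_pair _ T n @^-1` A) a).
Proof.
move=> mA; apply: measurable_xsection; rewrite -[_ @^-1` _]setTI.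
exact: measurable_cons_pair.
Qed.

End cylinders.

(** * The finitely additive product measure on cylinders *)

Section cylinder_measure.
Context d (T : measurableType d) (R : realType) (P : probability T R).
Local Notation S := (sequence_space T).
Local Open Scope ereal_scope.

(** True by computation: the product measure is defined by integrating the measures of sections. *)
Lemma power_probabilityS n (A : set (n.+1.-tuple T)) :
  power_probability P n.+1 A =
  \int[P]_a power_probability P n (xsection (@cons_pair _ T n @^-1` A) a).
Proof. by []. Qed.

(** There is only one empty tuple, so [A] is empty or full, and [B] is then the same by injectivity
    of preimages under [initial n]. *)
Lemma power_probability0 n (A : set (0.-tuple T)) (B : set (n.-tuple T)) :
  initial 0 @^-1` A = initial n @^-1` B ->
  power_probability P 0 A = power_probability P n B.
Proof.
move=> AB; have [A0|A0] := pselect (A [tuple]).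
  have AT : A = setT by apply/seteqP; split=> // t _; rewrite (tuple0 t).
  suff -> : B = setT by rewrite AT !probability_setT.
  by apply: (@preimage_initial_inj _ T); rewrite -AB AT !preimage_setT.
have A_0 : A = set0 by apply/seteqP; split=> // t; rewrite (tuple0 t).
suff -> : B = set0 by rewrite A_0 !measure0.
by apply: (@preimage_initial_inj _ T); rewrite -AB A_0 !preimage_set0.
Qed.

(** Consistency of the finite products: the induction removes the first coordinate on both sides,
    and the sections still describe one common set of sequences. *)
Lemma power_probability_initial m n (A : set (m.-tuple T))
    (B : set (n.-tuple T)) :
  initial m @^-1` A = initial n @^-1` B ->
  power_probability P m A = power_probability P n B.
Proof.
elim: m n A B => [|m IH] n A B AB; first exact: power_probability0.
case: n B AB => [|n] B AB; first exact/esym/power_probability0.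
rewrite !power_probabilityS; apply: eq_integral => a _; apply: IH.
by rewrite -!scons_initial AB.
Qed.

(** Some valid number of coordinates, not necessarily the least; by consistency the choice does not
    affect the measure of a cylinder. *)
Definition depth (E : set S) : nat := get [set n | cylinder n E].

Definition cylinder_measure (E : set S) : \bar R :=
  power_probability P (depth E) (@extend _ T (depth E) @^-1` E).

Lemma cylinder_measure_initial n (A : set (n.-tuple T)) : measurable A ->
  cylinder_measure (initial n @^-1` A) = power_probability P n A.
Proof.
move=> mA; rewrite /cylinder_measure; set E := initial n @^-1` A.
have [B mB EB] : cylinder (depth E) E.
  by apply: (@getPex _ [set n | cylinder n E]); exists n, A.
apply: power_probability_initial; rewrite -/E.
clearbody E; move: (depth E) B mB EB => m B _ ->.
by rewrite -comp_preimage; apply/seteqP; split=> x /=; rewrite extendK.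
Qed.

Lemma cylinder_measureE n E : cylinder n E ->
  cylinder_measure E = power_probability P n (@extend _ T n @^-1` E).
Proof.
move=> [A mA ->]; rewrite cylinder_measure_initial//.
congr (power_probability P n _).
by apply/seteqP; split=> t /=; rewrite extendK.
Qed.

Lemma measurable_extend_cylinder n E : cylinder n E ->
  measurable (@extend _ T n @^-1` E).
Proof.
move=> [A mA ->]; rewrite -comp_preimage (_ : _ \o _ = id)//.
by apply/funext => t /=; rewrite extendK.
Qed.

(** Over a common number of coordinates this is the corresponding property of a finite measure. *)
Lemma cylinder_measure_setD A B : measurable A -> measurable B -> B `<=` A ->
  cylinder_measure (A `\` B) = cylinder_measure A - cylinder_measure B.
Proof.
move=> [m cA] [n cB] BA; pose k := maxn m n.
have {}cA : cylinder k A by apply: cylinder_widen cA; rewrite leq_maxl.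
have {}cB : cylinder k B by apply: cylinder_widen cB; rewrite leq_maxr.
rewrite (cylinder_measureE (cylinderD cA cB)).
rewrite (cylinder_measureE cA) (cylinder_measureE cB).
rewrite -[_ @^-1` (A `\` B)]/(_ @^-1` A `\` _ @^-1` B) measureD; last first.
- rewrite (le_lt_trans (probability_le1 _ _)) ?ltry//.
  exact: measurable_extend_cylinder.
- exact: measurable_extend_cylinder.
- exact: measurable_extend_cylinder.
by rewrite setIidr//; exact: preimage_subset.
Qed.

Lemma cylinder_measure_setU A B : measurable A -> measurable B ->
  [disjoint A & B] ->
  cylinder_measure (A `|` B) = cylinder_measure A + cylinder_measure B.
Proof.
move=> [m cA] [n cB] AB0; pose k := maxn m n.
have {}cA : cylinder k A by apply: cylinder_widen cA; rewrite leq_maxl.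
have {}cB : cylinder k B by apply: cylinder_widen cB; rewrite leq_maxr.
have cAB : cylinder k (A `|` B).
  case: cA cB => [A' mA' ->] [B' mB' ->].
  by exists (A' `|` B') => //; exact: measurableU.
rewrite (cylinder_measureE cAB).
rewrite (cylinder_measureE cA) (cylinder_measureE cB) preimage_setU measureU//.
- exact: measurable_extend_cylinder.
- exact: measurable_extend_cylinder.
- by rewrite -preimage_setI; move/disj_set2P: AB0 => ->; rewrite preimage_set0.
Qed.

End cylinder_measure.

(** * Continuity at the empty set and extension to a probability measure *)

Section cylinder_continuity.
Context d (T : measurableType d) (R : realType) (P : probability T R).
Local Notation S := (sequence_space T).
Local Notation c := (cylinder_measure P).
Local Open Scope ereal_scope.

Lemma cylinder_scons n a (E : set S) :
  cylinder n.+1 E -> cylinder n (scons a @^-1` E).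
Proof.
move=> [A mA ->]; exists (xsection (@cons_pair _ T n @^-1` A) a).
  exact: measurable_section.
exact: scons_initial.
Qed.

Lemma cylinders_scons a (E : set S) :
  cylinders E -> cylinders (scons a @^-1` E).
Proof.
move=> [n cE]; exists n; apply: cylinder_scons.
exact: (cylinder_widen (leqnSn n)).
Qed.

Lemma measurable_cylinder_measure_scons (E : set S) : cylinders E ->
  measurable_fun setT (fun a => c (scons a @^-1` E)).
Proof.
(* Widening to [n.+1] coordinates ensures that there is a first coordinate to fix, even when [n] is
   0. *)
move=> [n /(cylinder_widen (leqnSn n))[A mA ->]].
rewrite (_ : (fun _ => _) = (fun a => power_probability P n
  (xsection (@cons_pair _ T n @^-1` A) a))).
  apply: (measurable_fun_xsection (power_probability P n)).
  by rewrite -[_ @^-1` _]setTI; exact: measurable_cons_pair.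
apply/funext => a; rewrite scons_initial cylinder_measure_initial//.
exact: measurable_section.
Qed.

Lemma cylinder_measure_scons (E : set S) : cylinders E ->
  c E = \int[P]_a c (scons a @^-1` E).
Proof.
move=> [n /(cylinder_widen (leqnSn n))[A mA ->]].
rewrite cylinder_measure_initial// power_probabilityS.
apply: eq_integral => a _; rewrite scons_initial cylinder_measure_initial//.
exact: measurable_section.
Qed.

Lemma cylinder_measure_ge0 E : 0 <= c E.
Proof. exact: measure_ge0. Qed.

Lemma cylinder_measure_le1 E : cylinders E -> c E <= 1.
Proof.
move=> [n cE]; rewrite (cylinder_measureE P cE).
by apply: probability_le1; exact: measurable_extend_cylinder.
Qed.

Lemma cylinder_measure0 : c set0 = 0.
Proof. by rewrite /cylinder_measure preimage_set0 measure0. Qed.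

(** The last clause is mere failure of convergence to 0, without an explicit lower bound; this form
    passes to a suitable section. *)
Definition nonvanishing (D : nat -> set S) :=
  [/\ forall k, cylinders (D k), nonincreasing_seq D &
      ~ (c (D k) @[k --> \oo] --> 0)].

(* If all the sections had measure tending to 0, dominated convergence would
   give the same for the sets themselves. *)
Lemma nonvanishing_scons D : nonvanishing D ->
  exists a, nonvanishing (fun k => scons a @^-1` D k).
Proof.
move=> [cD ndD nc]; apply: contrapT => /forallNP nv; apply: nc.
have s0 a : c (scons a @^-1` D k) @[k --> \oo] --> 0.
  apply: contrapT => h; apply: (nv a); split => // [k|m n mn].
    exact: cylinders_scons.
  by apply/subsetPset; apply: preimage_subset; apply/subsetPset/ndD.
have [] := @dominated_convergence _ _ _ P setT measurableT
  (fun k a => c (scons a @^-1` D k)) (cst 0) (cst 1).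
- by move=> k; exact: measurable_cylinder_measure_scons.
- exact: measurable_cst.
- exact: aeW.
- exact: (finite_measure_integrable_cst P 1%R).
- apply: aeW => a k _; rewrite gee0_abs ?cylinder_measure_ge0//=.
  exact/cylinder_measure_le1/cylinders_scons.
move=> _ _; rewrite integral0 => h.
rewrite (eq_cvg _ _ (g := fun k => \int[P]_a c (scons a @^-1` D k)))//.
by move=> k; exact: cylinder_measure_scons.
Qed.

Definition splice (x : S) n (y : S) : S :=
  fun i => if (i < n)%N then x i else y (i - n)%N.

Lemma splice_scons x n y : splice x n (scons (x n) y) = splice x n.+1 y.
Proof.
apply/funext => i; rewrite /splice ltnS.
case: ltngtP => [//|ni|->]; last by rewrite subnn.
by rewrite -(subnSK ni).
Qed.

(** Fixing one coordinate after another, while keeping the sections nonvanishing, builds a sequence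
    [x] that lies in every [D k]. *)
Lemma nonvanishing_bigcap D : nonvanishing D -> \bigcap_k D k !=set0.
Proof.
move=> nvD.
pose g (E : nat -> set S) :=
  get [set a | nonvanishing (fun k => scons a @^-1` E k)].
pose next (E : nat -> set S) k := scons (g E) @^-1` E k.
pose Dn n := iter n next D.
have nvDn n : nonvanishing (Dn n).
  elim: n => // n IH; rewrite /Dn iterS -/(Dn n).
  apply: (@getPex _ [set a | nonvanishing (fun k => scons a @^-1` Dn n k)]).
  exact: nonvanishing_scons.
pose x n := g (Dn n).
have DnE n k : Dn n k = splice x n @^-1` D k.
  elim: n => [|n IH].
    by apply/seteqP; split=> y; rewrite /Dn/= (_ : splice x 0 y = y)//;
      apply/funext => i; rewrite /splice subn0.
  rewrite /Dn iterS -/(Dn n) /next IH -/(x n).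
  by apply/seteqP; split=> y /=; rewrite splice_scons.
exists x => k _; apply: contrapT => xDk.
have [cD _ _] := nvD; have [n [A _ DkE]] := cD k.
(* [D k] depends only on the first [n] coordinates, and in [Dn n k] these are already those of [x];
   so if [x] misses [D k], the section is empty. *)
have Dnk0 : Dn n k = set0.
  apply/seteqP; split => // y; rewrite DnE DkE /=.
  rewrite (_ : initial n (splice x n y) = initial n x).
    by move: xDk; rewrite DkE.
  by apply: eq_from_tnth => i; rewrite !tnth_mktuple /splice ltn_ord.
have [_ nd] := nvDn n; apply.
(* From index [k] on, the decreasing sections are empty and their measures are 0, against
   nonvanishing. *)
apply: cvg_near_cst; near=> j; rewrite -cylinder_measure0; congr (c _).
apply/seteqP; split => //; rewrite -Dnk0; apply/subsetPset/nd.
by near: j; exact: nbhs_infty_ge.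
Unshelve. all: by end_near. Qed.

Lemma cylinder_measure_bigsetU (F : (set S)^nat) n :
  (forall i, cylinders (F i)) -> trivIset setT F ->
  c (\big[setU/set0]_(i < n) F i) = \sum_(0 <= i < n) c (F i).
Proof.
move=> cF tF; elim: n => [|n IH].
  by rewrite big_ord0 big_nil cylinder_measure0.
rewrite big_ord_recr big_nat_recr//= -IH cylinder_measure_setU//.
- by apply: (@bigsetU_measurable _ S) => i _; exact: cF.
- exact: cF.
- apply/disj_set2P; apply: (trivIset_bigsetUI (D := predT)) => //.
  exact: sub_trivIset tF.
Qed.

(** Finite additivity reduces the claim to the remainders [D n] having measures that tend to 0.
    Otherwise they would share a point, which would lie in some [F k] although [D k.+1] excludes
    [F k]. *)
Lemma cylinder_measure_semi_sigma_additive :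
  semi_sigma_additive (c : set S -> \bar R).
Proof.
move=> F cF tF cU; set U := \bigcup_n F n.
pose D n := U `\` \big[setU/set0]_(i < n) F i.
have cB n : cylinders (\big[setU/set0]_(i < n) F i).
  by apply: (@bigsetU_measurable _ S) => i _; exact: cF.
have BU n : \big[setU/set0]_(i < n) F i `<=` U.
  by rewrite -bigcup_mkord => x [i _ Fix]; exists i.
have fU : c U \is a fin_num.
  rewrite ge0_fin_numE ?cylinder_measure_ge0//.
  by rewrite (le_lt_trans (cylinder_measure_le1 cU)) ?ltry.
have D0 : c (D k) @[k --> \oo] --> 0.
  apply: contrapT => nv.
  have [] : \bigcap_k D k !=set0.
    apply: nonvanishing_bigcap; split => //.
      by move=> k; exact: cylindersD.
    move=> m n mn; apply/subsetPset; apply: setDS.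
    rewrite -!bigcup_mkord => x [i /= im Fix]; exists i => //=.
    exact: leq_trans mn.
  move=> x xD; have [[k _ xk] _] := xD 0%N I.
  by have [_] := xD k.+1 I; apply; rewrite -bigcup_mkord; exists k => /=.
have -> : (fun n => \sum_(0 <= i < n) c (F i)) = (fun n => c U - c (D n)).
  apply/funext => n; rewrite -cylinder_measure_bigsetU//.
  rewrite cylinder_measure_setD//; last exact: cB.
  rewrite fin_num_oppeB//; first by rewrite addeA subee// add0e.
  rewrite ge0_fin_numE ?cylinder_measure_ge0//.
  by rewrite (le_lt_trans (cylinder_measure_le1 (cB n))) ?ltry.
rewrite -[X in _ --> X]sube0; apply: (cvgeB _ (cvg_cst _) D0).
by rewrite fin_num_adde_defr.
Qed.

HB.instance Definition _ := isMeasure.Build d S R (c : set S -> \bar R)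
  cylinder_measure0 cylinder_measure_ge0 cylinder_measure_semi_sigma_additive.

Let Q : set (g_sigma_algebraType (@measurable _ S)) -> \bar R :=
  measure_extension c.

HB.instance Definition _ := Measure.on Q.

Let QT : Q setT = 1.
Proof.
rewrite /Q /measure_extension measurable_mu_extE//=.
rewrite (cylinder_measureE P (n := 0%N)) ?preimage_setT ?probability_setT//.
by exists setT.
Qed.

HB.instance Definition _ := Measure_isProbability.Build _ _ _ Q QT.

(** [X] is the identity, from the generated sigma-algebra to a type that carries only the algebra of
    cylinders; hence measurability and law are stated for initial segments. *)
Lemma iid_sequence : exists (dO : measure_display) (Omega : measurableType dO)
    (Q : probability Omega R) (X : Omega -> sequence_space T),
  forall n, measurable_fun setT (@initial _ T n \o X) /\
    forall A, measurable A ->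
      Q ((@initial _ T n \o X) @^-1` A) = power_probability P n A.
Proof.
exists _, _, Q, id => n; split.
  move=> _ A mA; rewrite setTI; apply: sub_sigma_algebra; exists n.
  by exists A.
move=> A mA /=; rewrite /Q /measure_extension.
have cA : cylinders (initial n @^-1` A) by exists n, A.
by rewrite [LHS](measurable_mu_extE c cA)/= cylinder_measure_initial.
Qed.

End cylinder_continuity.

(** * Independence of the last coordinate in a finite product *)

Section unsnoc.
Context d (T : measurableType d) (R : realType) (P : probability T R).
Local Open Scope ereal_scope.

(** [power_probability] adds coordinates in front, whereas the newest step of a walk comes last. *)
Definition unsnoc n (t : n.+1.-tuple T) : n.-tuple T * T :=
  ([tuple tnth t (widen_ord (leqnSn n) i) | i < n], tnth t ord_max).

Lemma measurable_unsnoc n : measurable_fun setT (@unsnoc n).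
Proof.
apply/measurable_fun_pairP; split.
  apply/measurable_fun_tnthP => i.
  rewrite (_ : _ \o _ = @tnth _ _ ^~ (widen_ord (leqnSn n) i)); last first.
    by apply/funext => t /=; rewrite tnth_mktuple.
  exact: measurable_tnth.
exact: measurable_tnth.
Qed.

HB.instance Definition _ n :=
  isMeasurableFun.Build _ _ _ _ (@unsnoc n) (@measurable_unsnoc n).

Lemma unsnoc_cons n a (t : n.+1.-tuple T) :
  unsnoc (cons_pair (a, t)) = (cons_pair (a, (unsnoc t).1), (unsnoc t).2).
Proof.
congr pair; last by rewrite -[RHS](tnthS a); congr tnth; exact/val_inj.
apply: eq_from_tnth => i; rewrite tnth_mktuple.
have [j ->|->] := unliftP ord0 i; last first.
  rewrite /cons_pair/= tnth0 (_ : widen_ord _ _ = ord0) ?tnth0//.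
  exact/val_inj.
rewrite /cons_pair/= tnthS tnth_mktuple.
rewrite (_ : widen_ord _ _ = lift ord0 (widen_ord (leqnSn n) j)) ?tnthS//.
exact/val_inj.
Qed.

(** Induction by sections over the first coordinate, which commute with splitting off the last. For
    [n = 0] the single coordinate is both, and the integrand is a multiple of the indicator of
    [B]. *)
Lemma power_probability_unsnocX n (A : set (n.-tuple T)) (B : set T) :
  measurable A -> measurable B ->
  power_probability P n.+1 (@unsnoc n @^-1` (A `*` B)) =
  power_probability P n A * P B.
Proof.
move=> + mB; elim: n A => [|n IH] A mA; rewrite power_probabilityS.
  rewrite (eq_integral (fun a => power_probability P 0 A * (\1_B a)%:E));
    last first.
    move=> a _; rewrite indicE; case: (boolP (a \in B)) => aB.
      rewrite mule1; congr (power_probability P 0 _); apply/seteqP.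
      split=> t; rewrite /xsection/= inE /=.
        by case; rewrite (tuple0 t) [X in A X](tuple0 _).
      move=> At; split; last by rewrite -[tnth _ _]/a -inE.
      by rewrite (tuple0 [tuple _ | _ < 0]) -(tuple0 t).
    rewrite mule0 (_ : xsection _ _ = set0) ?measure0//.
    apply/seteqP; split=> t//; rewrite /xsection/= inE /= => -[_].
    by move/negP: aB; rewrite inE.
  rewrite ge0_integralZl//; last exact/measurable_EFinP.
  by rewrite integral_indic// setIT.
rewrite (eq_integral (fun a => power_probability P n
    (xsection (@cons_pair _ T n @^-1` A) a) * P B)); last first.
  move=> a _; rewrite -IH//; last exact: measurable_section.
  congr (power_probability P n.+1 _); apply/seteqP.
  split=> t; first move=> /xsectionP; last move=> [/xsectionP At Bt];
    last apply/xsectionP; rewrite /preimage /mkset unsnoc_cons => //.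
  by move=> [At Bt]; split => //; exact/xsectionP.
rewrite ge0_integralZr//.
apply: (measurable_fun_xsection (power_probability P n)).
by rewrite -[_ @^-1` _]setTI; exact: measurable_cons_pair.
Qed.

Lemma power_probability_unsnoc n (C : set (n.-tuple T * T)) : measurable C ->
  power_probability P n.+1 (@unsnoc n @^-1` C) =
  (power_probability P n \x P) C.
Proof.
move=> mC; apply/esym.
apply: (@product_measure_unique _ _ _ _ _ (power_probability P n) P
  (distribution (power_probability P n.+1) (@unsnoc n))) => //.
exact: power_probability_unsnocX.
Qed.

End unsnoc.

(** * Random walks with i.i.d. steps and their Markov property *)

Section random_walk.
Context d (S : measurableType d) (R : realType) (P : probability S R).
Context (add : S -> S -> S)
  (madd : measurable_fun setT (fun p : S * S => add p.1 p.2)).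
Local Open Scope ereal_scope.

Lemma measurable_add_l b : measurable_fun setT (add b).
Proof. exact: (measurableT_comp madd (pair1_measurable b)). Qed.

HB.instance Definition _ b :=
  isMeasurableFun.Build _ _ _ _ (add b) (measurable_add_l b).

Definition walk_kernel (b : S) : {measure set S -> \bar R} :=
  distribution P (add b).

Lemma measurable_walk_kernel A : measurable A ->
  measurable_fun setT (walk_kernel ^~ A).
Proof.
move=> mA; rewrite (_ : (fun _ => _) =
    P \o xsection ((fun p : S * S => add p.1 p.2) @^-1` A)).
  by apply: measurable_fun_xsection; rewrite -[_ @^-1` _]setTI; exact: madd.
apply/funext => b /=; congr (P _).
by apply/seteqP; split=> x; rewrite /xsection/= inE.
Qed.

HB.instance Definition _ :=
  isKernel.Build _ _ _ _ _ walk_kernel measurable_walk_kernel.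

Lemma walk_kernelT b : walk_kernel b setT = 1.
Proof. exact: probability_setT. Qed.

HB.instance Definition _ :=
  Kernel_isProbability.Build _ _ _ _ _ walk_kernel walk_kernelT.

Fixpoint walk (b : S) (t : nat) (x : sequence_space S) : S :=
  if t is s.+1 then add (walk b s x) (x s) else b.

(** Only the steps of index below [t] enter the position at time [t]. *)
Lemma walk_initial b t n x : (t <= n)%N ->
  walk b t (extend (initial n x)) = walk b t x.
Proof.
elim: t => //= t IH tn; rewrite IH ?(ltnW tn)//; congr add.
by rewrite /extend -(tnth_nth _ _ (Ordinal tn)) tnth_mktuple.
Qed.

Lemma measurable_walk_extend b t n : (t <= n)%N ->
  measurable_fun setT (fun u : n.-tuple S => walk b t (extend u)).
Proof.
elim: t => [|t IH] tn; first exact: measurable_cst.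
apply: (measurableT_comp madd
  (g := fun u => (walk b t (extend u), extend u t))).
apply: measurable_fun_pair; first exact: IH (ltnW tn).
rewrite (_ : (fun _ => _) = @tnth _ _ ^~ (Ordinal tn)); last first.
  by apply/funext => u; rewrite (tnth_nth point).
exact: measurable_tnth.
Qed.

(** The history up to time [t] is a function of the first [t] steps, and step number [t] is
    independent of them; integrating it out first leaves the kernel. *)
Lemma random_walk_markov : exists (dO : measure_display)
    (Omega : measurableType dO) (Q : probability Omega R)
    (B : nat -> {RV Q >-> S}), markov_process B (fun=> walk_kernel).
Proof.
have [dO [V [Q [X XP]]]] := iid_sequence P.
have mX n := (XP n).1.
(* Any starting point will do, as [markov_process] prescribes no initial law. *)
pose b0 : S := point.
have walkE t n w : (t <= n)%N -> walk b0 t (X w) =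
    (fun u => walk b0 t (extend u)) ((@initial _ S n \o X) w).
  by move=> tn; rewrite /= walk_initial.
have mB t : measurable_fun setT (fun w => walk b0 t (X w)).
  rewrite (_ : (fun _ => _) =
      (fun u => walk b0 t (extend u)) \o (@initial _ S t \o X)).
    by apply: measurableT_comp; [exact: measurable_walk_extend|exact: mX].
  by apply/funext => w; exact: walkE.
pose B t := mfun_Sub (mem_set (mB t)) : {RV Q >-> S}.
exists dO, V, Q, B => t E A hE mA.
(* An event of the history lies in every sigma-algebra that contains the generators, in particular
   in that of the events determined by the first [t] steps. *)
have [D mD ->] : exists2 D, measurable D & E = (@initial _ S t \o X) @^-1` D.
  have : preimage_set_system setT (@initial _ S t \o X) measurable E.
    apply: hE; split.
      exact: sigma_algebra_preimage (sigma_algebra_measurable _).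
    move=> _ [s /= st [C mC <-]].
    exists ((fun u => walk b0 s (extend u)) @^-1` C).
      rewrite -[_ @^-1` C]setTI; exact: measurable_walk_extend.
    by apply/seteqP; split=> w /= [_]; rewrite walk_initial.
  by case=> D mD <-; exists D; rewrite ?setTI.
pose step (p : t.-tuple S * S) := add (walk b0 t (extend p.1)) p.2.
have mstep : measurable_fun setT step.
  apply: (measurableT_comp madd (g := fun p => (walk b0 t (extend p.1), p.2))).
  apply: measurable_fun_pair => //.
  by apply: (measurableT_comp (measurable_walk_extend b0 (leqnn t))).
(* The event in question, as a set of pairs made of the first [t] steps and the next one. *)
pose C := (D `*` setT) `&` step @^-1` A.
have mC : measurable C.
  apply: measurableI; first exact: measurableX.
  by rewrite -[_ @^-1` _]setTI; exact: mstep.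
transitivity (power_probability P t.+1 (@unsnoc _ S t @^-1` C)).
  rewrite -(XP t.+1).2; last first.
    by rewrite -[_ @^-1` _]setTI; exact: measurable_unsnoc.
  congr (Q _).
  have uE w : unsnoc (initial t.+1 (X w)) = (initial t (X w), X w t).
    congr pair; last by rewrite tnth_mktuple.
    by apply: eq_from_tnth => i; rewrite !tnth_mktuple.
  apply/seteqP; split=> w.
    move=> [Dw Aw]; change (C (unsnoc (initial t.+1 (X w)))); rewrite uE.
    by split; [split|rewrite /preimage/mkset/step walk_initial].
  rewrite -[X in X -> _]/(C (unsnoc (initial t.+1 (X w)))) uE => -[[Dw _]].
  by rewrite /preimage/mkset/step walk_initial.
rewrite power_probability_unsnoc// /product_measure1.
(* The section of [C] at [u] is empty outside [D]; inside, it consists of the steps leading from the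
   current position into [A]. *)
transitivity (\int[power_probability P t]_(u in D)
    walk_kernel (walk b0 t (extend u)) A).
  rewrite [RHS]integral_mkcond; apply: eq_integral => u _.
  rewrite patchE; case: ifPn => uE /=.
    congr (P _); apply/seteqP; split=> s;
      rewrite /xsection/= inE /C/step/=; first by case.
    by move=> ?; split => //; split => //; rewrite -inE.
  rewrite (_ : xsection _ _ = set0) ?measure0//; apply/seteqP; split=> s //.
  by rewrite /xsection/= inE /C /= => -[[]]; move/negP: uE; rewrite inE.
have mk : measurable_fun setT
    (fun u : t.-tuple S => walk_kernel (walk b0 t (extend u)) A).
  exact: (measurableT_comp (measurable_walk_kernel mA)
    (measurable_walk_extend b0 (leqnn t))).
transitivity (\int[pushforward Q (@initial _ S t \o X)]_(u in D)
    walk_kernel (walk b0 t (extend u)) A).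
  apply/esym/eq_measure_integral => [|? F mF _]; first exact: mX.
  exact: (XP t).2.
rewrite ge0_integral_pushforward//=.
- by apply: eq_integral => w _ /=; rewrite walk_initial.
- exact: mX.
- by move=> ?; exact: measurable_funTS.
Qed.

End random_walk.

(** * Measurable representatives and translation invariance on the circle *)

Section circle.
Variable R : realType.
Implicit Types (x y : R) (a b : circle R).

Definition frac x : R := x - (Num.floor x)%:~R.

Lemma measurable_frac : measurable_fun setT frac.
Proof.
apply: measurable_funB => //; apply: nondecreasing_measurable => // x y xy.
by rewrite ler_int le_floor.
Qed.

Lemma frac_itv x : 0 <= frac x < 1.
Proof.
have /andP[fx xf] := floor_itv x; rewrite /frac subr_ge0 fx/=.
by rewrite ltrBlDr addrC -[X in _ + X]/(1%:~R) -intrD.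
Qed.

Lemma circle_proj_frac x : circle_proj (frac x) = circle_proj x.
Proof.
by apply/circle_projP; rewrite /frac addrAC subrr add0r rpredN; apply: intr_int.
Qed.

Lemma frac_int x y : x - y \is a Num.int -> frac x = frac y.
Proof.
move=> xy; rewrite /frac -(subrK y x) floorDzr// intrD floorK//.
by rewrite opprD addrACA subrr add0r.
Qed.

(** [repr] returns an unspecified real representative; its fractional part is the one in [[0, 1)]
    and depends measurably on [a]. *)
Definition circle_repr a : R := frac (repr a).

Lemma circle_reprK a : circle_proj (circle_repr a) = a.
Proof. by rewrite circle_proj_frac /circle_proj reprK. Qed.

Lemma circle_repr_itv a : 0 <= circle_repr a < 1.
Proof. exact: frac_itv. Qed.

Lemma circle_repr_proj x : circle_repr (circle_proj x) = frac x.
Proof. by apply/frac_int/circle_projP; rewrite {1}/circle_proj reprK. Qed.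

Lemma measurable_circle_repr :
  measurable_fun setT (circle_repr : circle R -> measurableTypeR R).
Proof.
move=> _ A mA; rewrite setTI.
(* Measurability on the circle is by definition that of the preimage in the reals, where
   [circle_repr] becomes [frac]. *)
rewrite [measurable _]/(measurable
  (setT `&` (@circle_proj R) @^-1` (circle_repr @^-1` A))).
rewrite (_ : _ @^-1` _ = frac @^-1` A); first exact: measurable_frac.
by apply/seteqP; split=> x /=; rewrite circle_repr_proj.
Qed.

Lemma circle_projD x y : circle_proj (x + y) = circle_proj x + circle_proj y.
Proof. by rewrite /circle_proj raddfD. Qed.

Lemma measurable_circle_add :
  measurable_fun setT (fun p : circle R * circle R => p.1 + p.2).
Proof.
rewrite (_ : (fun _ => _) = @circle_proj R \o
    (fun p : circle R * circle R => circle_repr p.1 + circle_repr p.2)).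
  apply: measurableT_comp; first exact: measurable_circle_proj.
  by apply: measurable_funD; apply: measurableT_comp measurable_circle_repr _.
by apply/funext => p /=; rewrite circle_projD !circle_reprK.
Qed.

Local Notation mu := (@lebesgue_measure R).

(** Lebesgue measure is determined by the lengths of half-open intervals, which translations
    preserve. *)
Lemma lebesgue_measureD y (A : set R) : measurable A ->
  mu ((+%R y) @^-1` A) = mu A.
Proof.
move=> mA; have my : measurable_fun setT (+%R y : R -> measurableTypeR R).
  exact: measurable_funD.
apply/esym.
apply: (@lebesgue_measure_unique R
  (pushforward mu (+%R y : R -> measurableTypeR R))) => //.
move=> _ [[a b]] _ <-; rewrite /= /pushforward.
rewrite (_ : _ @^-1` _ = [set` Interval (BRight (a - y)) (BRight (b - y))]).
  rewrite !lebesgue_measure_itv/= !lte_fin ltrD2r -!EFinB.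
  by rewrite opprD addrACA subrr addr0.
by apply/seteqP; split=> x /=; rewrite !in_itv/= ltrBlDl lerBrDl.
Qed.

Definition circle_uniform : probability (circle R) R :=
  distribution (uniform_prob (@ltr01 R)) (@circle_proj R).

(** The uniform law lives on [[0, 1]]; dropping the null endpoint 1 leaves exactly one
    representative of each class. *)
Lemma circle_uniformE (A : set (circle R)) : measurable A ->
  circle_uniform A = mu (@circle_proj R @^-1` A `&` `[0, 1[).
Proof.
move=> mA; rewrite /circle_uniform/= /distribution /pushforward /uniform_prob.
have mS : measurable (@circle_proj R @^-1` A : set (measurableTypeR R)).
  by rewrite -[_ @^-1` _]setTI; exact: measurable_circle_proj.
rewrite integral_uniform_pdf.
rewrite (eq_integral (cst 1%E)); last first.
  move=> x; rewrite inE /= in_itv/= /uniform_pdf => -[_ ->].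
  by rewrite subr0 invr1.
rewrite integral_cst ?mul1e; last exact: measurableI.
rewrite -(@setUitv1 _ _ (BLeft 0) 1 true) ?bnd_simp ?ler01// setIUr measureU0//.
- exact: measurableI.
- exact: measurableI.
- apply/eqP; rewrite eq_le measure_ge0 andbT -(lebesgue_measure_set1 1).
  apply: le_measure; rewrite ?inE//; exact: measurableI.
Qed.

(** On the line, translation by [y] replaces [[0, 1)] by [[y, y + 1)], and the preimage [S] of [A]
    is 1-periodic, so the piece beyond 1 can be moved back. *)
Lemma circle_uniform_translation a (A : set (circle R)) : measurable A ->
  circle_uniform ((fun b => b + a) @^-1` A) = circle_uniform A.
Proof.
move=> mA; set S := @circle_proj R @^-1` A.
have mS : measurable (S : set (measurableTypeR R)).
  by rewrite -[S]setTI; exact: measurable_circle_proj.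
have /andP[y0 y1] := circle_repr_itv a; set y := circle_repr a in y0 y1.
have mA' : measurable ((fun b => b + a) @^-1` A).
  rewrite -[_ @^-1` _]setTI.
  exact: (measurableT_comp measurable_circle_add (pair2_measurable a)).
rewrite !circle_uniformE// -/S.
rewrite (_ : _ `&` _ = (+%R y) @^-1` (S `&` `[y, y + 1[)); last first.
  rewrite preimage_setI; congr (_ `&` _); apply/seteqP; split=> x /=.
  - by rewrite /S/= addrC circle_projD circle_reprK.
  - by rewrite /S/= addrC circle_projD circle_reprK.
  - by rewrite !in_itv/= lerDl ltrD2l.
  - by rewrite !in_itv/= lerDl ltrD2l.
rewrite lebesgue_measureD; last exact: measurableI.
have splitS u v w : u <= v -> v <= w -> mu (S `&` `[u, w[) =
    (mu (S `&` `[u, v[) + mu (S `&` `[v, w[))%E.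
  move=> uv vw; rewrite -measureU; [|exact: measurableI|exact: measurableI|].
    rewrite -setIUr; congr (mu (_ `&` _)); apply/seteqP.
    split=> x /=; rewrite !in_itv/=.
      by move=> /andP[-> ->]; have [?|?] := ltP x v; [left|right].
    move=> [/andP[-> /lt_le_trans]|/andP[/(le_trans uv) -> ->]]//; exact.
  rewrite -setIIr (_ : `[u, v[ `&` `[v, w[ = set0) ?setI0//.
  apply/seteqP; split=> x //=; rewrite !in_itv/= => -[/andP[_ +] /andP[+ _]].
  by rewrite leNgt => ->.
rewrite (splitS _ 1)//; [|exact: ltW|by rewrite lerDr].
rewrite [RHS](splitS _ y)//; last exact: ltW.
rewrite addeC; congr (_ + _)%E.
(* Shifting by 1 takes [[1, y + 1)] to [[0, y)], the piece missing from [[y, 1)]. *)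
rewrite -(@lebesgue_measureD 1 (S `&` `[1, y + 1[)); last exact: measurableI.
have proj1D x : circle_proj (1 + x) = circle_proj x.
  by apply/circle_projP; rewrite addrK rpred1.
congr (mu _); rewrite preimage_setI; congr (_ `&` _).
  by apply/seteqP; split=> x; rewrite /S/= proj1D.
apply/seteqP; split=> x /=.
- by rewrite !in_itv/= lerDl addrC ltrD2r.
- by rewrite !in_itv/= lerDl addrC ltrD2r.
Qed.

End circle.

(** * Addition and characters on the torus *)

Section torus.
Context (R : realType) (d : nat).
Implicit Types (a b : torus R d) (r : d.-tuple nat).

Definition torus_repr a : d.-tuple R := map_tuple (@circle_repr R) a.

Lemma torus_reprK a : torus_proj (torus_repr a) = a.
Proof.
by apply: eq_from_tnth => i; rewrite !tnth_map circle_reprK.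
Qed.

Lemma in_cube_torus_repr a : in_cube (torus_repr a).
Proof.
move=> i; rewrite tnth_map.
by have /andP[-> /ltW ->] := circle_repr_itv (tnth a i).
Qed.

Lemma measurable_torus_repr :
  measurable_fun setT (torus_repr : torus R d -> d.-tuple (measurableTypeR R)).
Proof.
apply/measurable_fun_tnthP => i.
rewrite (_ : _ \o _ = @circle_repr R \o @tnth _ _ ^~ i).
  apply: (measurableT_comp (@measurable_circle_repr R)).
  exact: measurable_tnth.
by apply/funext => a /=; rewrite tnth_map.
Qed.

Lemma measurable_torus_proj :
  measurable_fun setT
    (@torus_proj R d : d.-tuple (measurableTypeR R) -> torus R d).
Proof.
apply/measurable_fun_tnthP => i.
rewrite (_ : _ \o _ = @circle_proj R \o @tnth _ _ ^~ i).
  apply: (measurableT_comp (@measurable_circle_proj R)).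
  exact: measurable_tnth.
by apply/funext => a /=; rewrite tnth_map.
Qed.

Definition torus_add a b : torus R d := [tuple tnth a i + tnth b i | i < d].

Lemma measurable_torus_add :
  measurable_fun setT (fun p : torus R d * torus R d => torus_add p.1 p.2).
Proof.
apply/measurable_fun_tnthP => i.
rewrite (_ : _ \o _ = (fun p : circle R * circle R => p.1 + p.2) \o
    (fun p : torus R d * torus R d => (tnth p.1 i, tnth p.2 i))).
  apply: (measurableT_comp (@measurable_circle_add R)).
  by apply: measurable_fun_pair; apply: (measurableT_comp (measurable_tnth i)).
by apply/funext => p /=; rewrite tnth_mktuple.
Qed.

Lemma cisD (x y : R) : cis (x + y) = cis x * cis y.
Proof.
rewrite /cis mulrDr cosD sinD; apply/eqP.
by rewrite eq_complex/= eqxx addrC eqxx.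
Qed.

(** By [torus_charE] any representatives may be used, and on these [dot] is additive in its first
    argument. *)
Lemma torus_charD r a b :
  torus_char r (torus_add a b) = torus_char r a * torus_char r b.
Proof.
rewrite -[a in LHS]torus_reprK -[b in LHS]torus_reprK.
rewrite (_ : torus_add _ _ = torus_proj
  [tuple tnth (torus_repr a) i + tnth (torus_repr b) i | i < d]); last first.
  by apply: eq_from_tnth => i; rewrite !(tnth_map, tnth_mktuple) circle_projD.
rewrite -{2}(torus_reprK a) -{2}(torus_reprK b) !torus_charE -cisD; congr cis.
rewrite /dot -big_split; apply: eq_bigr => i _.
by rewrite !tnth_mktuple mulrDl.
Qed.

(** [torus_char] is defined through the unspecified [repr]; its measurability comes from the
    measurable [torus_repr], which yields the same value. *)
Lemma measurable_dot_torus_repr r :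
  measurable_fun setT (fun a : torus R d => 2 * pi * dot (torus_repr a) r : R).
Proof.
apply: measurable_funM => //; apply: measurable_sum => i.
apply: measurable_funM => //.
apply: (measurableT_comp (measurable_tnth i) measurable_torus_repr).
Qed.

Lemma measurable_Re_torus_char r :
  measurable_fun setT (fun a : torus R d => complex.Re (torus_char r a)).
Proof.
rewrite (_ : (fun _ => _) = cos \o (fun a => 2 * pi * dot (torus_repr a) r)).
  apply: measurableT_comp (measurable_dot_torus_repr r).
  by apply: continuous_measurable_fun; exact: continuous_cos.
by apply/funext => a; rewrite -[in LHS](torus_reprK a) torus_charE.
Qed.

Lemma measurable_Im_torus_char r :
  measurable_fun setT (fun a : torus R d => complex.Im (torus_char r a)).
Proof.
rewrite (_ : (fun _ => _) = sin \o (fun a => 2 * pi * dot (torus_repr a) r)).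
  apply: measurableT_comp (measurable_dot_torus_repr r).
  by apply: continuous_measurable_fun; exact: continuous_sin.
by apply/funext => a; rewrite -[in LHS](torus_reprK a) torus_charE.
Qed.

Lemma integrable_le1 d' (T : measurableType d') (P : probability T R)
    (f : T -> R) : measurable_fun setT f -> (forall x, `|f x| <= 1) ->
  P.-integrable setT (EFin \o f).
Proof.
move=> mf f1; apply: measurable_bounded_integrable => //.
  by rewrite (le_lt_trans (probability_le1 _ _)) ?ltry.
exists 1; split; first exact: num_real.
by move=> M M1 x _ /=; exact: le_trans (f1 x) (ltW M1).
Qed.

Lemma integrable_Re_torus_char d' (T : measurableType d')
    (P : probability T R) (X : T -> torus R d) r : measurable_fun setT X ->
  P.-integrable setT (EFin \o (fun w => complex.Re (torus_char r (X w)))).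
Proof.
move=> mX; apply: integrable_le1.
  exact: (measurableT_comp (measurable_Re_torus_char r) mX).
by move=> x; exact: cos_max.
Qed.

Lemma integrable_Im_torus_char d' (T : measurableType d')
    (P : probability T R) (X : T -> torus R d) r : measurable_fun setT X ->
  P.-integrable setT (EFin \o (fun w => complex.Im (torus_char r (X w)))).
Proof.
move=> mX; apply: integrable_le1.
  exact: (measurableT_comp (measurable_Im_torus_char r) mX).
by move=> x; exact: sin_max.
Qed.

Lemma cintegral_distribution d' (T : measurableType d')
    (P : probability T R) (X : {RV P >-> torus R d}) r :
  cintegral (distribution P X) (torus_char r) =
  cintegral P (fun w => torus_char r (X w)).
Proof.
rewrite /cintegral /Rintegral; congr (fine _ +i* fine _).
  rewrite integral_distribution//.
    exact: (measurableT_comp (@EFin_measurable _ _)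
      (measurable_Re_torus_char r)).
  exact: integrable_Re_torus_char.
rewrite integral_distribution//.
  exact: (measurableT_comp (@EFin_measurable _ _)
    (measurable_Im_torus_char r)).
exact: integrable_Im_torus_char.
Qed.

Lemma cintegral_torus_charZ (P : probability (torus R d) R) r a :
  cintegral P (fun b => torus_char r a * torus_char r b) =
  cintegral P (torus_char r) * torus_char r a.
Proof.
have iRe := @integrable_Re_torus_char _ _ P id r (@measurable_id _ _ _).
have iIm := @integrable_Im_torus_char _ _ P id r (@measurable_id _ _ _).
have iZ k f : P.-integrable setT (EFin \o f) ->
    P.-integrable setT (EFin \o (fun b => k * f b)).
  by move=> intf; exact: (integrableZl measurableT k intf).
rewrite mulrC /cintegral; case: (torus_char r a) => x y.
apply/eqP; rewrite eq_complex/=; apply/andP; split; apply/eqP.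
  by rewrite RintegralB ?RintegralZl//; exact: iZ.
by rewrite RintegralD ?RintegralZl//; exact: iZ.
Qed.

End torus.

(** * Invariance of the uniform distribution on the torus *)

(** Induction on [d]: with the first coordinate fixed, the others are translated by the tail of [a];
    the first is then translated by a change of variables on the circle. *)
Lemma torus_uniform_translation (R : realType) d (a : torus R d)
    (A : set (torus R d)) : measurable A ->
  torus_uniform R d ((fun b => torus_add b a) @^-1` A) = torus_uniform R d A.
Proof.
elim: d a A => [|d IH] a A mA.
  congr (torus_uniform R 0 _).
  have E b : torus_add b a = b by apply: eq_from_tnth => -[].
  by apply/seteqP; split=> b /=; rewrite E.
rewrite /torus_uniform !power_probabilityS.
pose g (x : circle R) :=
  torus_uniform R d (xsection (@cons_pair _ (circle R) d @^-1` A) x).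
have mg : measurable_fun setT g.
  apply: (measurable_fun_xsection (torus_uniform R d)).
  by rewrite -[_ @^-1` _]setTI; exact: measurable_cons_pair.
pose a' : torus R d := [tuple of behead a].
pose tr (x : circle R) := x + thead a.
have mtr : measurable_fun setT tr.
  exact: (measurableT_comp (@measurable_circle_add R)
    (pair2_measurable (thead a))).
transitivity (\int[circle_uniform R]_x g (tr x))%E.
  apply: eq_integral => x _.
  rewrite /g -(IH a'); last exact: measurable_section.
  congr (power_probability _ d _); apply/seteqP.
  have E (t : torus R d) :
      torus_add (cons_pair (x, t)) a = cons_pair (tr x, torus_add t a').
    apply: eq_from_tnth => i; rewrite tnth_mktuple.
    have [j ->|->] := unliftP ord0 i; last by rewrite [RHS]tnth0.
    rewrite [RHS](tnthS (tr x) (torus_add t a')) tnth_mktuple tnth_behead.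
    congr (_ + tnth a _); first exact: (tnthS x t).
    by apply/val_inj; rewrite /= inordK ?ltnS.
  split=> t.
    by move=> /xsectionP; rewrite /preimage/mkset E => ?; exact/xsectionP.
  by move=> /xsectionP ?; apply/xsectionP; rewrite /preimage/mkset E.
transitivity (\int[pushforward (circle_uniform R) tr]_x g x)%E.
  by rewrite [RHS]ge0_integral_pushforward.
by apply: eq_measure_integral => B mB _; exact: circle_uniform_translation.
Qed.

(** The integral is the mass under [U \x P] of the pairs with sum in [A]. Integrating over the
    starting point first, with the step fixed, gives [U A] by translation invariance. *)
Lemma walk_kernel_torus_stationary (R : realType) d
    (P : probability (torus R d) R) (A : set (torus R d)) : measurable A ->
  (\int[torus_uniform R d]_a walk_kernel P (@measurable_torus_add R d) a A)%E =
  torus_uniform R d A.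
Proof.
move=> mA; set U := torus_uniform R d.
pose C := (fun p : torus R d * torus R d => torus_add p.1 p.2) @^-1` A.
have mC : measurable C.
  by rewrite -[C]setTI; exact: measurable_torus_add.
transitivity ((U \x P) C)%E.
  apply: eq_integral => a _ /=; congr (P _); apply/seteqP.
  by split=> b; [move=> ?; exact/xsectionP|move=> /xsectionP].
transitivity ((U \x^ P) C)%E.
  apply: (@product_measure_unique _ _ _ _ _ U P (U \x^ P)%E) => //.
  by move=> B D mB mD; exact: product_measure2E.
rewrite /product_measure2 (eq_integral (cst (U A))) => [|b _].
  by rewrite integral_cst//= probability_setT mule1.
rewrite /= -(torus_uniform_translation b mA); congr (U _); apply/seteqP.
by split=> a; [move=> /ysectionP|move=> ?; exact/ysectionP].
Qed.

(** * Passing between transition kernels and the variable [W] *)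

(** Turns the value of a kernel at a point, a measure of mass 1, into a [probability]; dividing by
    the mass changes nothing. *)
Lemma probability_of_measure d (T : measurableType d) (R : realType)
    (m : {measure set T -> \bar R}) : m setT = 1%E ->
  exists P : probability T R, P = m :> (set T -> \bar R).
Proof.
move=> m1; exists (mnormalize m (dirac point)).
by apply/funext => A; rewrite /= /mnormalize m1 onee_eq0/= invr1 mule1.
Qed.

Theorem proposition7 (R : realType) (d : nat) (hd : (1 <= d)%N)
    (rho : d.-tuple nat -> R[i]) :
  (exists (dO : measure_display) (Omega : measurableType dO)
      (P : probability Omega R) (B : nat -> {RV P >-> torus R d})
      (K : nat -> R.-pker torus R d ~> torus R d),
    [/\ markov_process B K,
        time_homogeneous K,
        stationary (torus_uniform R d) K
      & forall (t : nat) (r : d.-tuple nat) (a : d.-tuple R),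
          (1 <= t)%N -> in_cube a ->
          cond_expectation_step K t (torus_char r) (torus_proj a) =
            rho r * cis (dot a r)])
  <->
  (exists (dO : measure_display) (Omega : measurableType dO)
      (P : probability Omega R) (W : {RV P >-> d.-tuple R}),
    (forall w : Omega, in_cube (W w)) /\
    forall r : d.-tuple nat, rho r = cintegral P (fun w => cis (dot (W w) r))).
Proof.
split.
- move=> [dO [V [Q [B [K [_ _ _ KE]]]]]].
  (* At the origin every character equals 1, so the eigenvector equation there isolates [rho r]. *)
  pose o : d.-tuple R := [tuple 0 | i < d].
  have oE r : dot o r = 0.
    by rewrite /dot big1// => i _; rewrite tnth_mktuple mul0r.
  have [P PE] := probability_of_measure
    (@prob_kernel _ _ _ _ _ (K 0%N) (torus_proj o)).
  pose W : {RV P >-> d.-tuple R} :=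
    mfun_Sub (mem_set (@measurable_torus_repr R d)).
  exists _, (torus R d), P, W; split; first exact: in_cube_torus_repr.
  (* The expectation at time 1 is taken with [K 0], because of the predecessor in
     [cond_expectation_step]. *)
  move=> r; have := KE 1%N r o isT.
  rewrite oE (_ : cis 0 = 1) ?mulr1; last first.
    by rewrite /cis mulr0 cos0 sin0.
  rewrite /cond_expectation_step /cintegral /Rintegral -PE => <-; last first.
    by move=> i; rewrite tnth_mktuple lexx ler01.
  congr (fine _ +i* fine _); apply: eq_integral => a _;
  by rewrite -[in LHS](torus_reprK a) torus_charE.
- move=> [dO [V [Q [W [_ rhoE]]]]].
  have mX : measurable_fun setT (fun w => torus_proj (W w)).
    exact: (measurableT_comp (@measurable_torus_proj R d) (measurable_funPT W)).
  pose X : {RV Q >-> torus R d} := mfun_Sub (mem_set mX).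
  pose P := distribution Q X.
  have [d' [V' [Q' [B mB]]]] :=
    random_walk_markov P (@measurable_torus_add R d).
  exists d', V', Q', B, (fun=> walk_kernel P (@measurable_torus_add R d)).
  split => //.
    by move=> t A mA; exact: walk_kernel_torus_stationary.
  move=> t r a _ _; rewrite /cond_expectation_step /=.
  (* The kernel at a point is an image of [P], itself the image of [Q] under [X]: variables are
     changed twice, and the character is factored in between. *)
  rewrite cintegral_distribution.
  under [X in cintegral _ X]funext do rewrite /= torus_charD.
  rewrite cintegral_torus_charZ torus_charE rhoE; congr (_ * _).
  rewrite cintegral_distribution; congr (cintegral _ _).
  by apply/funext => w; rewrite /= torus_charE.
Qed.
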